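(* Let $X$ and $Y$ be Hausdorff spaces and let $f:X\to Y$ be a continuous surjection that is closed and sequence-covering, where $X$ is $g$-metrizable. Then $f$ is a 1-sequence-covering map.
   Context: A *weak base* for a space $X$ is a cover $\mathcal P=\bigcup_{x\in X}\mathcal P_x$ of $X$ such that for each $x\in X$: (a) if $U,V\in\mathcal P_x$ then $W\subset U\cap V$ for some $W\in\mathcal P_x$; (b) $x\in\bigcap\mathcal P_x$, and if $x\in U$ with $U$ open in $X$ then $P\subset U$ for some $P\in\mathcal P_x$; and moreover (c) whenever $G\subset X$ is such that for each $x\in G$ there is $P\in\mathcal P_x$ with $P\subset G$, then $G$ is open in $X$. A space is *$g$-metrizable* if it is regular and has a $\sigma$-locally finite weak base (a weak base which is a countable union of locally finite families). A map $f:X\to Y$ is *sequence-covering* if whenever $\{y_n\}$ is a convergent sequence in $Y$ there is a convergent sequence $\{x_n\}$ in $X$ with $x_n\in f^{-1}(y_n)$ for each $n$. $f$ is *1-sequence-covering* if for each $y\in Y$ there is $x\in f^{-1}(y)$ such that whenever $\{y_n\}$ is a sequence converging to $y$ in $Y$ there is a sequence $\{x_n\}$ converging to $x$ in $X$ with $x_n\in f^{-1}(y_n)$ for each $n$. *)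

(* Defs.v *)
From mathcomp Require Import all_boot all_classical.
From mathcomp Require Import all_analysis.
Set Implicit Arguments.
Unset Strict Implicit.
Unset Printing Implicit Defensive.
Local Open Scope classical_set_scope.

Definition locally_finite (X : topologicalType) (F : set (set X)) : Prop :=
  forall x : X, exists2 U : set X,
    nbhs x U & finite_set [set A | F A /\ A `&` U !=set0].

Definition sigma_locally_finite (X : topologicalType) (F : set (set X)) :
    Prop :=
  exists2 G : nat -> set (set X),
    (forall n, locally_finite (G n)) & F = \bigcup_n G n.

Record weak_base (X : topologicalType) (B : X -> set (set X)) : Prop := {
  weak_base_cover : cover (\bigcup_x B x) id = setT;
  weak_base_directed : forall x U V, B x U -> B x V ->
    exists2 W, B x W & W `<=` U `&` V;
  weak_base_mem : forall x, (\bigcap_(P in B x) P) x;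
  weak_base_refines : forall x U, open U -> U x -> exists2 P, B x P & P `<=` U;
  weak_base_open : forall G : set X,
    (forall x, G x -> exists2 P, B x P & P `<=` G) -> open G }.

Definition g_metrizable (X : topologicalType) : Prop :=
  regular_space X /\
  exists2 B : X -> set (set X), weak_base B & sigma_locally_finite (\bigcup_x B x).

Definition closed_map (X Y : topologicalType) (f : X -> Y) : Prop :=
  forall C : set X, closed C -> closed (f @` C).

(* Convergence is spelled out with an explicit limit: [cvgn] relies on [lim],
   which needs a pointed space. *)
Definition convergent_seq (X : topologicalType) (u : nat -> X) : Prop :=
  exists l : X, u @ \oo --> l.

Definition sequence_covering (X Y : topologicalType) (f : X -> Y) : Prop :=
  forall v : nat -> Y, convergent_seq v ->
    exists2 u : nat -> X, convergent_seq u & forall n, f (u n) = v n.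

Definition one_sequence_covering (X Y : topologicalType) (f : X -> Y) : Prop :=
  forall y : Y, exists2 x : X, f x = y &
    forall v : nat -> Y, v @ \oo --> y ->
      exists2 u : nat -> X, u @ \oo --> x & forall n, f (u n) = v n.

(* Main.v *)
(* Call A bad (for y) if some sequence converging to y avoids f(A). If some x in
   the fibre over y belongs to no bad member of its weak base, then every sequence
   converging to y lifts to a sequence converging to x. Otherwise, f being closed,
   a sequence converging to y meets only finitely many f(A) infinitely often, A in
   a given locally finite family; hence countably many sequences s_i suffice to
   avoid all the bad sets. Interleaving s_0, ..., s_k and lifting the result gives
   a limit x_k in the fibre, and a diagonal argument yields a subsequence of (x_k)
   with a limit x. If P is a bad weak base member at x, and s_i avoids f(P), then
   the diagonal argument applied to the lifts of s_i near the x_k gives a sequence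
   outside P converging to x, whereas P is a sequential neighbourhood of x. *)
Require Import Defs.
From mathcomp Require Import all_boot all_classical.
From mathcomp Require Import all_analysis.
Local Open Scope classical_set_scope.

(** * Subsequences and finite sets of points *)

Lemma cvg_reindex (T : topologicalType) (u : nat -> T) (x : T) (p : nat -> nat) :
  (forall m, (m <= p m)%N) -> u @ \oo --> x -> (u \o p) @ \oo --> x.
Proof.
move=> lep ux; apply: cvg_comp ux => U [N _ NU].
by exists N => // n /= Nn; apply: NU; apply: leq_trans (lep n).
Qed.

Lemma not_near_infty (P : set nat) :
  ~ (\forall n \near \oo, P n) ->
  exists2 p : nat -> nat, forall m, (m <= p m)%N & forall m, ~ P (p m).
Proof.
move=> nP.
have /choice[p pP] : forall m, exists n, (m <= n)%N /\ ~ P n.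
  move=> m; apply: contrapT => H; apply: nP; exists m => // n /= mn.
  by apply: contrapT => Pn; apply: H; exists n.
by exists p => m; have [] := pP m.
Qed.

Lemma nbhs_finite_avoid (T : topologicalType) (I : Type) (D : set I)
    (w : I -> T) (z : T) :
  hausdorff_space T -> finite_set D -> (forall i, D i -> w i <> z) ->
  \forall t \near z, forall i, D i -> w i <> t.
Proof.
move=> hT fD wz.
have cl : closed (w @` D).
  have [H _] := @accessible_finite_set_closed T.
  by apply: H; [exact: hausdorff_accessible | exact: finite_image].
have : nbhs z (~` (w @` D)).
  apply: open_nbhs_nbhs; split; first exact: closed_openC.
  by move=> [i Di wiz]; exact: (wz i).
by apply: filterS => t nwt i Di wit; apply: nwt; exists i.
Qed.

(** * Weak bases at a point *)

Lemma weak_base_in (X : topologicalType) (B : X -> set (set X)) (x : X) P :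
  weak_base B -> B x P -> P x.
Proof. by move=> wB BP; have := @weak_base_mem _ _ wB x; exact. Qed.

Lemma weak_base_nbhs (X : topologicalType) (B : X -> set (set X)) (x : X) U :
  weak_base B -> nbhs x U -> exists2 P, B x P & P `<=` U.
Proof.
move=> wB; rewrite nbhsE => -[V [oV Vx] VU].
have [P BP PV] := weak_base_refines wB oV Vx.
by exists P => //; exact: subset_trans VU.
Qed.

(** A subsequence [w] outside [P] would have a range with open complement: [P] serves at [x], and at
    other points Hausdorff separation leaves finitely many terms to avoid. As [x] lies in this
    complement, [w] cannot converge to [x]. *)
Lemma weak_base_cvg (X : topologicalType) (B : X -> set (set X)) (x : X) P
    (u : nat -> X) :
  hausdorff_space X -> weak_base B -> B x P -> u @ \oo --> x ->
  \forall n \near \oo, P (u n).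
Proof.
move=> hX wB BP ux; apply: contrapT => /not_near_infty[p lep npP].
have wx := cvg_reindex _ _ _ _ lep ux.
set w := u \o p in wx.
have oG : open (~` range w).
  apply: (weak_base_open wB) => z nz.
  have [zx|zx] := pselect (z = x).
    exists P; first by rewrite zx.
    by move=> t Pt [n _ wnt]; apply: (npP n); rewrite [u _]wnt.
  have zx' : z != x by apply/eqP.
  move: (hX); rewrite open_hausdorff => /(_ _ _ zx')[[V W] /= [Vz Wx] [oV oW VW]].
  have [N _ NW] : \forall n \near \oo, W (w n).
    by apply: wx; apply: open_nbhs_nbhs; split=> //; rewrite inE in Wx.
  have nV : nbhs z V by apply: open_nbhs_nbhs; split=> //; rewrite inE in Vz.
  have Dz : forall i, `I_N i -> w i <> z by move=> i _ wiz; apply: nz; exists i.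
  have nN := @nbhs_finite_avoid X nat `I_N w z hX (finite_II N) Dz.
  have [P' BP' P'V] := weak_base_nbhs _ _ _ _ wB (filterI nV nN).
  exists P' => // t /P'V[Vt Nt] [n _ wnt].
  have [nN'|Nn] := ltnP n N; first by apply: (Nt n).
  have : (V `&` W) t by split=> //; rewrite -wnt; exact: NW.
  by rewrite (eqP VW).
have nx : nbhs x (~` range w).
  apply: open_nbhs_nbhs; split=> // -[n _ wnx].
  by apply: (npP n); rewrite [u _]wnx; exact: weak_base_in BP.
have [N _ NG] := wx _ nx.
by apply: (NG N (leqnn N)); exists N.
Qed.

(** All members of [B x] contain [x], and a locally finite family has only finitely many such
    members. *)
Lemma weak_base_countable (X : topologicalType) (B : X -> set (set X)) (x : X) :
  weak_base B -> sigma_locally_finite (\bigcup_x B x) -> countable (B x).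
Proof.
move=> wB [F lfF BF].
have -> : B x = \bigcup_(n in setT) (B x `&` F n).
  rewrite -setI_bigcupr -BF; apply/seteqP; split=> [P BP|P []//].
  by split=> //; exists x.
apply: bigcup_countable => // n _; apply: finite_set_countable.
have [U nU fU] := lfF n x.
apply: sub_finite_set fU => P [BP FP]; split=> //.
by exists x; split; [exact: weak_base_in BP | exact: nbhs_singleton].
Qed.

(** [Q n.+1] is chosen in [B x] inside both [Q n] and the next set of an enumeration of [B x]. *)
Lemma weak_base_decreasing (X : topologicalType) (B : X -> set (set X)) (x : X) :
  weak_base B -> sigma_locally_finite (\bigcup_x B x) ->
  exists Q : nat -> set X, [/\ forall n, B x (Q n),
    forall m n, (m <= n)%N -> Q n `<=` Q m &
    forall U, nbhs x U -> exists n, Q n `<=` U].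
Proof.
move=> wB sB.
have cB := weak_base_countable _ _ x wB sB.
have [P0 BP0 _] := weak_base_refines wB openT (I : setT x).
have /pfcard_geP[B0|[e]] := cB; first by rewrite B0 in BP0.
have /choice[g gP] : forall UV : set X * set X, exists W,
    B x UV.1 -> B x UV.2 -> B x W /\ W `<=` UV.1 `&` UV.2.
  move=> [U V]; have [[BU BV]|H] := pselect (B x U /\ B x V).
    by have [W BW WUV] := weak_base_directed wB BU BV; exists W.
  by exists U => /= BU BV; exfalso; apply: H.
pose Q := fix Q n := if n is m.+1 then g (Q m, e n) else e 0.
have Be n : B x (e n) by exact: funS.
have BQ n : B x (Q n).
  by elim: n => [|n IH] //=; have [] := gP (Q n, e n.+1) IH (Be n.+1).
have QS n : Q n.+1 `<=` Q n `&` e n.+1.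
  by have [] := gP (Q n, e n.+1) (BQ n) (Be n.+1).
exists Q; split=> //.
- move=> m n; elim: n => [|n IH]; first by rewrite leqn0 => /eqP->.
  rewrite leq_eqVlt => /orP[/eqP->//|/IH QQ].
  by move=> t /QS[/QQ].
- move=> U nU; have [P BP PU] := weak_base_nbhs _ _ _ _ wB nU.
  have [n _ en] := @surj _ _ _ _ e P BP.
  exists n; apply: subset_trans PU; rewrite -en.
  by case: n {en} => [|n] // t /QS[].
Qed.

(** * Closed maps and convergent subsequences *)

(** The range of [z] is not closed, since its image has [y] in its closure but not as an element.
    Hence some [x] outside the range has all members of [B x] meeting the range. *)
Lemma closed_map_cvg_subseq (X Y : topologicalType) (f : X -> Y)
    (B : X -> set (set X)) (z : nat -> X) (y : Y) :
  hausdorff_space X -> closed_map f -> weak_base B ->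
  sigma_locally_finite (\bigcup_x B x) ->
  (f \o z) @ \oo --> y -> (forall n, f (z n) <> y) ->
  exists2 p : nat -> nat, forall m, (m <= p m)%N &
    exists x : X, (z \o p) @ \oo --> x.
Proof.
move=> hX f_closed wB sB fzy fzNy.
have [x nzx Bz] : exists2 x, ~ range z x &
    forall P, B x P -> exists n, P (z n).
  apply: contrapT => H.
  have clz : closed (range z).
    rewrite -openC; apply: (weak_base_open wB) => x nzx.
    apply: contrapT => H'; apply: H; exists x => // P BP.
    apply: contrapT => nP; apply: H'; exists P => // t Pt [n _ znt].
    by apply: nP; exists n; rewrite znt.
  have clfz := f_closed _ clz.
  have [|t [n _ <-]] := clfz y.
  - move=> U /fzy[N _ NU]; exists (f (z N)); split; last exact: (NU N (leqnn N)).
    by exists (z N) => //; exists N.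
  - exact: fzNy.
have [Q [BQ Qdec Qnbhs]] := weak_base_decreasing _ _ x wB sB.
have /choice[p pP] : forall m, exists k, (m <= k)%N /\ Q m (z k).
  move=> m; have Dz : forall i, `I_m i -> z i <> x.
    by move=> i _ zix; apply: nzx; exists i.
  (* [Q j] excludes the terms of index below [m], so a term in both [Q j] and [Q m] has index at
     least [m]. *)
  have [j Qj] := Qnbhs _ (nbhs_finite_avoid _ _ _ _ _ hX (finite_II m) Dz).
  have [k Qk] := Bz _ (BQ (maxn j m)).
  exists k; split; last by apply: Qdec Qk; exact: leq_maxr.
  rewrite leqNgt; apply/negP => km.
  by apply: (Qj (z k) _ k km) => //; apply: Qdec Qk; exact: leq_maxl.
exists p => [m|]; first by have [] := pP m.
exists x => U /Qnbhs[n QU]; exists n => // m /= nm.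
by apply: QU; apply: Qdec nm _ _; have [] := pP m.
Qed.

(** Near [x] only finitely many members matter; the closures that miss [x] have a closed union,
    which a neighbourhood of [x] avoids. *)
Lemma locally_finite_near_closure (X : topologicalType) (F : set (set X)) (x : X) :
  locally_finite F -> \forall t \near x, forall A, F A -> A t -> closure A x.
Proof.
move=> lfF; have [U nU fU] := lfF x.
pose D := [set A | (F A /\ A `&` U !=set0) /\ ~ closure A x].
have fD : finite_set D by apply: sub_finite_set fU => A [].
have clD : closed (\bigcup_(A in D) closure A).
  by apply: closed_bigcup => // A _; exact: closed_closure.
have nD : nbhs x (~` \bigcup_(A in D) closure A).
  apply: open_nbhs_nbhs; split; first exact: closed_openC.
  by move=> [A [_ nA]].
near=> t => A FA At; apply: contrapT => nA.
have nDt : (~` \bigcup_(A in D) closure A) t by near: t.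
apply: nDt; exists A; last exact: subset_closure.
by split=> //; split=> //; exists t; split=> //; near: t.
Unshelve. all: by end_near. Qed.

(* The point [u k n] is chosen so close to [x k] that it lies in a member of one
   of the first [k] locally finite families only if [x k] lies in its closure;
   by regularity the limit of [u (p m) (q m)] is then also the limit of
   [x (p m)]. *)
Lemma diagonal_cvg (X Y : topologicalType) (f : X -> Y)
    (B : X -> set (set X)) (u : nat -> nat -> X) (x : nat -> X)
    (s : nat -> Y) (y : Y) :
  hausdorff_space X -> regular_space X -> closed_map f -> weak_base B ->
  sigma_locally_finite (\bigcup_x B x) ->
  s @ \oo --> y -> (forall n, s n <> y) ->
  (forall k, u k @ \oo --> x k) -> (forall k n, f (u k n) = s n) ->
  exists p q : nat -> nat, exists x' : X, [/\ forall m, (m <= p m)%N,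
    (x \o p) @ \oo --> x' & (fun m => u (p m) (q m)) @ \oo --> x'].
Proof.
move=> hX rX f_closed wB sB sy sNy ux fu.
have [F lfF BF] := sB.
have /choice[n nP] : forall k, exists n, (k <= n)%N /\
    forall j A, (j <= k)%N -> F j A -> A (u k n) -> closure A (x k).
  move=> k.
  have : \forall t \near x k, forall j : 'I_k.+1,
      forall A, F j A -> A t -> closure A (x k).
    by apply: filter_forall => j; exact: locally_finite_near_closure.
  move=> /(ux k)[N _ NP]; exists (maxn k N); split; first exact: leq_maxl.
  by move=> j A jk; apply: (NP _ (leq_maxr _ _) (Ordinal (jk : (j < k.+1)%N))).
have fz : (f \o (fun k => u k (n k))) @ \oo --> y.
  rewrite (_ : _ \o _ = s \o n); last by apply/funext => k /=; rewrite fu.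
  by apply: cvg_reindex => // k; have [] := nP k.
have fzN k : f (u k (n k)) <> y by rewrite fu.
have [p lep [x' zx']] := closed_map_cvg_subseq _ _ _ _ _ _ hX f_closed wB sB fz fzN.
exists p, (n \o p), x'; split=> // U nU.
have [V nV VU] := rX x' U nU.
have [P BP PV] := weak_base_nbhs _ _ _ _ wB nV.
have [j _ FP] : (\bigcup_j F j) P by rewrite -BF; exists x'.
have [N _ NP] := weak_base_cvg _ _ _ _ _ hX wB BP zx'.
exists (maxn j N) => // m /=; rewrite geq_max => /andP[jm Nm].
apply: VU; apply: closureS PV _ _.
have [_ np] := nP (p m); apply: (np j) => //; first exact: leq_trans (lep m).
exact: NP.
Qed.

(** * Sequences avoiding images of sets *)

Lemma finite_set_nat_avoid (S : set nat) :
  finite_set S -> \forall n \near \oo, ~ S n.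
Proof.
move=> /finite_seqP[s ->]; exists (\max_(i <- s) i).+1 => // n /= sn ns.
by have := @leq_bigmax_seq _ s xpredT id n ns isT; rewrite leqNgt sn.
Qed.

(** Otherwise points of distinct members [g i] map to terms of [s] of index at least [i]. A
    subsequence of them converges, and each neighbourhood of its limit meets infinitely many members
    of [F]. *)
Lemma locally_finite_frequently (X Y : topologicalType) (f : X -> Y)
    (B : X -> set (set X)) (F : set (set X)) (s : nat -> Y) (y : Y) :
  hausdorff_space X -> closed_map f -> weak_base B ->
  sigma_locally_finite (\bigcup_x B x) -> locally_finite F ->
  s @ \oo --> y -> (forall n, s n <> y) ->
  finite_set [set A | F A /\ ~ \forall n \near \oo, ~ (f @` A) (s n)].
Proof.
move=> hX f_closed wB sB lfF sy sNy; apply: contrapT => /infiniteP/pcard_leP[g].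
have gP i : F (g i) /\ ~ \forall n \near \oo, ~ (f @` (g i)) (s n) by exact: (@funS _ _ _ _ g).
have /choice[zn znP] : forall i, exists zn : X * nat,
    [/\ g i zn.1, f zn.1 = s zn.2 & (i <= zn.2)%N].
  move=> i; have [_ /not_near_infty[p lep pP]] := gP i.
  have /contrapT[z gz fz] := pP i.
  by exists (z, p i).
have fz : (f \o (fst \o zn)) @ \oo --> y.
  rewrite (_ : _ \o _ = s \o (snd \o zn)).
    by apply: cvg_reindex => // i; have [] := znP i.
  by apply/funext => i; have [] := znP i.
have fzN i : f ((fst \o zn) i) <> y by have [_ /= -> _] := znP i.
have [p lep [x zx]] := closed_map_cvg_subseq _ _ _ _ _ _ hX f_closed wB sB fz fzN.
have [U nU fU] := lfF x.
have /finite_set_nat_avoid[M _ gM] : finite_set (g @^-1` [set A | F A /\ A `&` U !=set0]).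
  by apply: finite_preimage fU => i j _ _; apply: inj; rewrite inE.
have [N _ NU] := zx _ nU.
apply: (gM (p (maxn M N))) => /=.
  exact: leq_trans (leq_maxl M N) (lep _).
split; first by have [] := gP (p (maxn M N)).
exists (zn (p (maxn M N))).1; split; first by have [] := znP (p (maxn M N)).
exact: (NU _ (leq_maxr M N)).
Qed.

(** Asking this of every term loses nothing: a sequence outside the image infinitely often has a
    subsequence always outside it. *)
Definition sequentially_avoided {X Y : topologicalType} (f : X -> Y) (y : Y)
    (A : set X) : Prop :=
  exists2 s : nat -> Y, s @ \oo --> y & forall n, ~ (f @` A) (s n).

(* Any one sequence already avoids all but finitely many of the images. *)
Lemma locally_finite_avoiding_seqs (X Y : topologicalType) (f : X -> Y)
    (B : X -> set (set X)) (F : set (set X)) (y : Y) :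
  hausdorff_space X -> closed_map f -> weak_base B ->
  sigma_locally_finite (\bigcup_x B x) -> locally_finite F ->
  exists S : set (nat -> Y), [/\ finite_set S,
    forall s, S s -> s @ \oo --> y /\ forall n, s n <> y &
    forall A, F A -> (f @` A) y -> sequentially_avoided f y A ->
      exists2 s, S s & \forall n \near \oo, ~ (f @` A) (s n)].
Proof.
move=> hX f_closed wB sB lfF.
pose bad A := [/\ F A, (f @` A) y & sequentially_avoided f y A].
have [[A0 [_ A0y [s0 s0y s0A]]]|nbad] := pselect (exists A, bad A); last first.
  exists set0; split=> // A FA Ay sA; exfalso; apply: nbad; by exists A.
have /choice[w wP] : forall A, exists s : nat -> Y, bad A ->
    s @ \oo --> y /\ forall n, ~ (f @` A) (s n).
  move=> A; have [[_ _ [s sy sA]]|nA] := pselect (bad A); first by exists s.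
  by exists s0 => /nA.
(* The image of [A0] contains [y], so a sequence avoiding it never takes the value [y]. *)
have s0N n : s0 n <> y by move=> e; apply: (s0A n); rewrite e.
have fE := locally_finite_frequently _ _ _ _ _ _ _ hX f_closed wB sB lfF s0y s0N.
set E := [set A | _ /\ _] in fE.
exists (s0 |` w @` (E `&` bad)); split.
- rewrite finite_setU; split; first exact: finite_set1.
  by apply: finite_image; exact: finite_setIl.
- move=> _ [->|[A [_ bA] <-]]; first by split.
  have [wy wA] := wP A bA; split=> // n e; apply: (wA n).
  by rewrite e; case: bA.
- move=> A FA Ay sA; have bA : bad A by split.
  have [EA|nE] := pselect (E A).
    exists (w A); first by right; exists A.
    by exists 0%N => // n _; have [_] := wP A bA.
  exists s0; first by left.
  by apply: contrapT => nn; apply: nE; split.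
Qed.

(** * Interleaved sequences and the point of the fibre *)

Lemma cvg_interleave (T : topologicalType) (s : nat -> nat -> T) (y : T) (k : nat) :
  (forall i, s i @ \oo --> y) ->
  (fun n => s (n %% k.+1) (n %/ k.+1)) @ \oo --> y.
Proof.
move=> sy U nU.
have [N _ NU] : \forall m \near \oo, forall i : 'I_k.+1, U (s i m).
  by apply: filter_forall => i; exact: sy.
exists (N * k.+1)%N => // n /= Nn.
by apply: (NU (n %/ k.+1) _ (Ordinal (ltn_pmod n (ltn0Sn k)))); rewrite /= leq_divRL.
Qed.

Lemma exists_sequentially_open_point (X Y : topologicalType) (f : X -> Y)
    (B : X -> set (set X)) (y : Y) :
  hausdorff_space X -> hausdorff_space Y -> continuous f ->
  set_surj setT setT f -> closed_map f -> sequence_covering f ->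
  regular_space X -> weak_base B -> sigma_locally_finite (\bigcup_x B x) ->
  exists2 x : X, f x = y & forall P (v : nat -> Y), B x P -> v @ \oo --> y ->
    \forall n \near \oo, (f @` P) (v n).
Proof.
move=> hX hY f_cont f_surj f_closed f_seq rX wB sB; apply: contrapT => H.
have bad x : f x = y -> exists2 P, B x P & sequentially_avoided f y P.
  move=> fx; apply: contrapT => nP; apply: H; exists x => // P v BP vy.
  apply: contrapT => /not_near_infty[p lep pP]; apply: nP.
  by exists P => //; exists (v \o p) => //; exact: cvg_reindex.
have [F lfF BF] := sB.
have /choice[S SP] := fun j =>
  locally_finite_avoiding_seqs _ _ _ _ _ y hX f_closed wB sB (lfF j).
have cS : countable (\bigcup_j S j).
  by apply: bigcup_countable => // j _; apply: finite_set_countable; have [] := SP j.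
have catch x : f x = y -> exists P s,
    [/\ B x P, (\bigcup_j S j) s & \forall n \near \oo, ~ (f @` P) (s n)].
  move=> fx; have [P BP sP] := bad x fx.
  have [j _ FP] : (\bigcup_j F j) P by rewrite -BF; exists x.
  have [_ _ SA] := SP j.
  have [|s Ss sn] := SA P FP _ sP.
    by exists x => //; exact: weak_base_in BP.
  by exists P, s; split=> //; exists j.
have [x0 _ fx0] := f_surj y I.
have /pfcard_geP[S0|[s]] := cS.
  by have [P [s [_ + _]]] := catch x0 fx0; rewrite S0.
have [sy sNy] : (forall i, s i @ \oo --> y) /\ (forall i n, s i n <> y).
  have sS i : s i @ \oo --> y /\ forall n, s i n <> y.
    have [j _ Sj] := @funS _ _ _ _ s i I.
    by have [_ SN _] := SP j; exact: SN.
  by split=> i; have [] := sS i.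
(* One lift of [t k] contains lifts of [s 0], ..., [s k] with a common limit [x k]. *)
pose t k n := s (n %% k.+1) (n %/ k.+1).
have ty k : t k @ \oo --> y by exact: cvg_interleave.
have /choice[ux uxP] : forall k, exists ux : (nat -> X) * X,
    ux.1 @ \oo --> ux.2 /\ forall n, f (ux.1 n) = t k n.
  move=> k; have [u [x ux] fu] := f_seq (t k) (ex_intro _ y (ty k)).
  by exists (u, x).
pose u k := (ux k).1; pose x k := (ux k).2.
have uxk k : u k @ \oo --> x k by have [] := uxP k.
have fx k : f (x k) = y.
  apply: (cvg_unique hY (F := (f \o u k) @ \oo)).
    by apply: continuous_cvg => //; exact: f_cont.
  rewrite (_ : f \o u k = t k); first exact: ty.
  by apply/funext => n; have [_ fu] := uxP k; exact: fu.
(* The terms of index congruent to [i] modulo [k.+1]: a lift of [s i] once [i <= k]. *)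
pose L i k n := u k (n * k.+1 + i)%N.
have Lx i k : L i k @ \oo --> x k.
  apply: (cvg_reindex _ (u k) _ (fun n => n * k.+1 + i)%N) => // n.
  by apply: leq_trans (leq_addr _ _); exact: leq_pmulr.
have fL i k n : (i <= k)%N -> f (L i k n) = s i n.
  move=> ik; have [_ ->] := uxP k; rewrite /t divnMDl // modnMDl.
  by rewrite modn_small ?divn_small // addn0.
(* Here [s 0] serves to extract a convergent subsequence of [x]. *)
have [p [q [x' [lep xx' _]]]] := diagonal_cvg _ _ _ _ _ _ _ _ hX rX f_closed wB sB
  (sy 0%N) (sNy 0%N) (Lx 0%N) (fun k n => fL 0%N k n (leq0n k)).
have fx' : f x' = y.
  apply: (cvg_unique hY (F := (f \o (x \o p)) @ \oo)).
    by apply: continuous_cvg => //; exact: f_cont.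
  rewrite (_ : f \o _ = cst y); first exact: cvg_cst.
  by apply/funext => k /=; exact: fx.
have [P [_ [BP /(@surj _ _ _ _ s)[i _ <-] [N _ NP]]]] := catch x' fx'.
pose s' n := s i (n + N)%N.
have s'y : s' @ \oo --> y.
  by apply: (cvg_reindex _ (s i) _ (fun n => n + N)%N) => // n; exact: leq_addr.
(* The shift by [i] ensures [i <= p (k + i)], so that [s i] is lifted; the shift by [N] keeps only
   terms outside the image of [P]. *)
pose L' k n := L i (p (k + i)%N) (n + N)%N.
have L'x k : L' k @ \oo --> x (p (k + i)%N).
  apply: (cvg_reindex _ (L i (p (k + i)%N)) _ (fun n => n + N)%N) => // n.
  exact: leq_addr.
have fL' k n : f (L' k n) = s' n.
  by apply: fL; apply: leq_trans (lep _); exact: leq_addl.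
have [p' [q' [x'' [lep' xx'' Lx'']]]] := diagonal_cvg _ _ _ _ L' _ _ _ hX rX f_closed
  wB sB s'y (fun n => sNy i _) L'x fL'.
have xE : x'' = x'.
  apply: (cvg_unique hX (F := (fun m => x (p (p' m + i)%N)) @ \oo)) => //.
  apply: (cvg_reindex _ (x \o p) _ (fun m => p' m + i)%N) => // m.
  exact: leq_trans (lep' m) (leq_addr _ _).
rewrite {}xE in Lx''.
have [M _ MP] := weak_base_cvg _ _ _ _ _ hX wB BP Lx''.
apply: (NP (q' M + N)%N) => /=; first exact: leq_addl.
by exists (L' (p' M) (q' M)); [exact: MP (leqnn M) | exact: fL'].
Qed.

Theorem theorem4p5 (X Y : topologicalType) (f : X -> Y)
    (hX : hausdorff_space X) (hY : hausdorff_space Y)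
    (f_cont : continuous f) (f_surj : set_surj setT setT f)
    (f_closed : closed_map f) (f_seq : sequence_covering f)
    (X_gmet : g_metrizable X) :
  one_sequence_covering f.
Proof.
move=> y; have [rX [B wB sB]] := X_gmet.
have [x fx xP] := exists_sequentially_open_point _ _ _ _ y hX hY f_cont f_surj
  f_closed f_seq rX wB sB.
exists x => // v vy.
have [Q [BQ Qdec Qnbhs]] := weak_base_decreasing _ _ x wB sB.
(* The deepest [Q m] whose image contains [v n] supplies [z]; as [Q] decreases, [z] then lies in all
   earlier ones. *)
have lift_upto n N : exists z, f z = v n /\
    forall m, (m < N)%N -> (f @` Q m) (v n) -> Q m z.
  elim: N => [|N [z [fz zQ]]].
    by have [z _ fz] := f_surj (v n) I; exists z.
  have [[z' Qz' fz']|nQ] := pselect ((f @` Q N) (v n)).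
    exists z'; split=> // m; rewrite ltnS => mN _; exact: Qdec mN _ Qz'.
  exists z; split=> // m; rewrite ltnS leq_eqVlt => /orP[/eqP->//|mN].
  exact: zQ.
have /choice[u uP] := fun n => lift_upto n n.+1.
exists u => [U /Qnbhs[m QU]|n]; last by have [] := uP n.
have [N _ NQ] := xP _ v (BQ m) vy.
exists (maxn m N) => // n /=; rewrite geq_max => /andP[mn Nn].
apply: QU; have [_ uQ] := uP n; apply: uQ; first by rewrite ltnS.
exact: NQ.
Qed.
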